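(* Let $\mathcal{E}=\mathbf{Set}$, let $M$ be a commutative monad on $\mathcal{E}$ with $M1\cong 1$, and let $(\mathbb{T},+,0)$ be a monoid. Let $\mathbf{Hier}|_{\mathcal{E}}$ be the monoidal bicategory of hierarchical systems between linear polynomials $Ay$. For each object $Ay$, let the discarding system $\mathsf{del}_A:Ay\to 1y$ be the system with trivial state space $1$, trivial update map and trivial output map, and let the copying system $\mathsf{copy}_A:Ay\to(A\times A)y$ be the system with trivial state space $1$, trivial update map, and output map $\mathbb{T}\times A\to A\times A$, $(t,a)\mapsto(a,a)$. Then $(Ay,\mathsf{copy}_A,\mathsf{del}_A)$ satisfies the comonoid laws with respect to $\otimes$, making $\mathbf{Hier}|_{\mathcal{E}}$ into a copy-discard category (laws being understood up to the canonical isomorphisms of state spaces such as $1\times 1\cong 1$).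
   Context: Write $\mathsf{dst}:MX\times MY\to M(X\times Y)$ for the double strength of $M$. For polynomials $p,q$, $[p,q]=\sum_{f:p\to q}y^{\sum_{i:p(1)}q[f_1(i)]}$ is the internal hom for the tensor $p\otimes q=\sum_{i:p(1)}\sum_{j:q(1)}y^{p[i]\times q[j]}$ (unit $y=1y$); $Ay$ denotes the linear polynomial $\sum_{a:A}y^1$, so $Ay\otimes By=(A\times B)y$. The bicategory $\mathbf{Hier}$ has polynomials as objects and hom-category $\mathbf{Coalg}_M^{\mathbb{T}}([p,q])$ from $p$ to $q$. Here, for a polynomial $r$, objects of $\mathbf{Coalg}_M^{\mathbb{T}}(r)$ are triples $(X,\vartheta^o,\vartheta^u)$ with $X$ a set, $\vartheta^o:\mathbb{T}\times X\to r(1)$, $\vartheta^u:\sum_{t:\mathbb{T}}\sum_{x:X}r[\vartheta^o(t,x)]\to MX$, such that for each section $\sigma$ of the bundle $\sum_{i:r(1)}r[i]\to r(1)$ the maps $\vartheta^\sigma(t):x\mapsto\vartheta^u(t,x,\sigma(\vartheta^o(t,x)))$ form a functor from the one-object category of $\mathbb{T}$ to the Kleisli category of $M$; morphisms are functions $f:X\to Y$ with $Mf\circ\vartheta^\sigma(t)=\psi^\sigma(t)\circ f$ for all $t,\sigma$. $\mathbf{Hier}|_{\mathcal{E}}$ is the restriction of $\mathbf{Hier}$ to linear polynomials. Explicitly, a system $\beta:Ay\to By$ in $\mathbf{Hier}|_{\mathcal{E}}$ consists of a state space $X$, an output map $\beta^o:\mathbb{T}\times X\times A\to B$ and an update map $\beta^u:\mathbb{T}\times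 X\times A\to MX$ (subject to the condition above). Composition is induced by the canonical map $[p,q]\otimes[q,r]\to[p,r]$ and by placing coalgebras in parallel: the composite of $\beta:Ay\to By$ (state space $X$) and $\gamma:By\to Cy$ (state space $Y$) has state space $X\times Y$, output $(t,x,y,a)\mapsto\gamma^o(t,y,\beta^o(t,x,a))$ and update $(t,x,y,a)\mapsto\mathsf{dst}(\beta^u(t,x,a),\gamma^u(t,y,\beta^o(t,x,a)))$. The tensor of systems has the product state space, the product output map, and the product of update maps followed by $\mathsf{dst}$. Identities have state space $1$ and constantly output the identity map. A copy-discard category is a symmetric monoidal category in which every object carries a commutative comonoid structure, compatibly with the monoidal product (the copy and discard maps need not be natural).
   Formalization: Composites in Hier|_E can violate the functor condition (e.g. M = Id, T = (N,+)), so Hier|_E is shown copy-discard when closed under composition and tensor; the laws also hold for any closed class of systems containing the stateless ones; equivalences must also preserve outputs. *)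

(* Defs.v *)
From mathcomp Require Import all_boot.

Set Implicit Arguments.
Unset Strict Implicit.
Unset Printing Implicit Defensive.

(** * Commutative monads on the category of types *)

Record monad := Monad {
  mobj :> Type -> Type;
  fmap : forall X Y : Type, (X -> Y) -> mobj X -> mobj Y;
  eta : forall X : Type, X -> mobj X;
  mu : forall X : Type, mobj (mobj X) -> mobj X;
  fmap_id : forall X (m : mobj X), fmap id m = m;
  fmap_comp : forall X Y Z (f : X -> Y) (g : Y -> Z) (m : mobj X),
    fmap (g \o f) m = fmap g (fmap f m);
  eta_nat : forall X Y (f : X -> Y) (x : X), fmap f (eta x) = eta (f x);
  mu_nat : forall X Y (f : X -> Y) (m : mobj (mobj X)),
    fmap f (mu m) = mu (fmap (fmap f) m);
  mu_eta : forall X (m : mobj X), mu (eta m) = m;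
  mu_fmap_eta : forall X (m : mobj X), mu (fmap (@eta X) m) = m;
  mu_mu : forall X (m : mobj (mobj (mobj X))), mu (mu m) = mu (fmap (@mu X) m)
}.
Arguments eta {_ _} _.
Arguments mu {_ _} _.

Definition strength (M : monad) X Y (x : X) (n : M Y) : M (X * Y)%type :=
  fmap (fun y => (x, y)) n.

Definition costrength (M : monad) X Y (m : M X) (y : Y) : M (X * Y)%type :=
  fmap (fun x => (x, y)) m.

Definition dst (M : monad) X Y (m : M X) (n : M Y) : M (X * Y)%type :=
  mu (fmap (fun x => strength x n) m).

Definition commutative_monad (M : monad) : Prop :=
  forall X Y (m : M X) (n : M Y),
    dst m n = mu (fmap (fun y => costrength m y) n).

Definition kleisli (M : monad) X Y Z (g : Y -> M Z) (f : X -> M Y) : X -> M Z :=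
  fun x => mu (fmap g (f x)).

(** * Polynomials *)

Record poly := Poly { pos : Type; dir : pos -> Type }.

Record lens (p q : poly) := Lens {
  onpos : pos p -> pos q;
  ondir : forall i : pos p, dir (onpos i) -> dir i
}.

Arguments ondir {p q} l {i} _.

Definition lens_comp (p q r : poly) (f : lens p q) (g : lens q r) : lens p r :=
  @Lens p r (fun i => onpos g (onpos f i))
    (fun i d => ondir f (ondir g d)).

Definition ptens (p q : poly) : poly :=
  @Poly (pos p * pos q)%type (fun ij => (dir ij.1 * dir ij.2)%type).

Definition ihom (p q : poly) : poly :=
  @Poly (lens p q) (fun f => {i : pos p & dir (onpos f i)}).

(** The canonical map [p,q] ⊗ [q,r] -> [p,r]. *)
Definition ihom_comp (p q r : poly) :
    lens (ptens (ihom p q) (ihom q r)) (ihom p r) :=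
  @Lens (ptens (ihom p q) (ihom q r)) (ihom p r)
    (fun fg => lens_comp fg.1 fg.2)
    (fun fg d =>
      (existT (fun i => dir (onpos fg.1 i)) (projT1 d)
              (ondir fg.2 (projT2 d)),
       existT (fun j => dir (onpos fg.2 j)) (onpos fg.1 (projT1 d))
              (projT2 d))).

Definition lens_tens (p q p' q' : poly) (f : lens p q) (g : lens p' q') :
    lens (ptens p p') (ptens q q') :=
  @Lens (ptens p p') (ptens q q') (fun ii => (onpos f ii.1, onpos g ii.2))
    (fun ii d => (ondir f d.1, ondir g d.2)).

(** The canonical map [p,q] ⊗ [p',q'] -> [p ⊗ p', q ⊗ q']. *)
Definition ihom_tens (p q p' q' : poly) :
    lens (ptens (ihom p q) (ihom p' q')) (ihom (ptens p p') (ptens q q')) :=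
  @Lens (ptens (ihom p q) (ihom p' q')) (ihom (ptens p p') (ptens q q'))
    (fun fg => lens_tens fg.1 fg.2)
    (fun fg d =>
      (existT (fun i => dir (onpos fg.1 i)) (projT1 d).1 (projT2 d).1,
       existT (fun i => dir (onpos fg.2 i)) (projT1 d).2 (projT2 d).2)).

Definition ihom_map (p q p' q' : poly) (u : lens p' p) (v : lens q q') :
    lens (ihom p q) (ihom p' q') :=
  @Lens (ihom p q) (ihom p' q')
    (fun f => lens_comp u (lens_comp f v))
    (fun f d =>
      existT (fun i => dir (onpos f i)) (onpos u (projT1 d))
             (ondir v (projT2 d))).

Definition lin (A : Type) : poly := @Poly A (fun _ => unit).

(** The two directions of the isomorphism (A × B)y ≅ Ay ⊗ By. *)
Definition lin_split (A B : Type) : lens (lin (A * B)) (ptens (lin A) (lin B)) :=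
  @Lens (lin (A * B)) (ptens (lin A) (lin B)) id (fun _ _ => tt).

Definition lin_merge (A B : Type) : lens (ptens (lin A) (lin B)) (lin (A * B)) :=
  @Lens (ptens (lin A) (lin B)) (lin (A * B)) id (fun _ _ => (tt, tt)).

Definition lin_map (A B : Type) (h : A -> B) : lens (lin A) (lin B) :=
  @Lens (lin A) (lin B) h (fun _ d => d).

(** * Coalgebras

    [coalg] is the underlying data [(X, ϑ°, ϑᵘ)] of an object of
    Coalg_M^T(r); the functoriality condition is the predicate [is_flow].
    The two are kept apart because [is_flow] is not preserved by the composition
    of systems: see [hier_not_closed] below. *)

Record coalg (M : monad) (T : Type) (r : poly) := Coalg {
  state : Type;
  out : T -> state -> pos r;
  upd : forall (t : T) (x : state), dir (out t x) -> M state
}.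

Arguments out {M T r} c _ _.
Arguments upd {M T r} c {t x} _.

Definition psection (r : poly) : Type := forall i : pos r, dir i.

Definition coalg_closure (M : monad) T r (th : coalg M T r) (s : psection r) (t : T) :
    state th -> M (state th) :=
  fun x => upd th (s (out th t x)).

Arguments coalg_closure {M T r} th s t _.

Definition is_flow (M : monad) (T : Type) (zero : T) (add : Monoid.law zero) r
    (th : coalg M T r) : Prop :=
  forall s : psection r,
    (forall x, coalg_closure th s zero x = eta x) /\
    (forall t1 t2 x, coalg_closure th s (add t1 t2) x
                     = kleisli (coalg_closure th s t1) (coalg_closure th s t2) x).

Definition coalg_mor (M : monad) T r (th ps : coalg M T r)
    (f : state th -> state ps) : Prop :=
  forall (t : T) (s : psection r) (x : state th),
    fmap f (coalg_closure th s t x) = coalg_closure ps s t (f x).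

(** Morphisms of coalgebras do not constrain outputs: since M1 ≅ 1, any two
    systems with state space 1 are isomorphic as coalgebras, whatever they
    output. An identification of systems therefore also requires the bijection
    of state spaces to preserve outputs. *)
Definition coalg_iso (M : monad) T r (th ps : coalg M T r)
    (f : state th -> state ps) : Prop :=
  (exists g : state ps -> state th,
    [/\ cancel f g, cancel g f, coalg_mor f & coalg_mor g]) /\
  (forall t x, out ps t (f x) = out th t x).

(** The canonical isomorphisms of state spaces: those generated by the symmetric
    monoidal structure of (×, 1). *)
Inductive canonical : forall X Y : Type, (X -> Y) -> Prop :=
| canon_id X : @canonical X X id
| canon_comp X Y Z (f : X -> Y) (g : Y -> Z) :
    canonical f -> canonical g -> canonical (g \o f)
| canon_prod X Y X' Y' (f : X -> Y) (f' : X' -> Y') :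
    canonical f -> canonical f' ->
    @canonical (X * X') (Y * Y') (fun p => (f p.1, f' p.2))
| canon_assoc X Y Z :
    @canonical (X * Y * Z) (X * (Y * Z)) (fun p => (p.1.1, (p.1.2, p.2)))
| canon_associ X Y Z :
    @canonical (X * (Y * Z)) (X * Y * Z) (fun p => (p.1, p.2.1, p.2.2))
| canon_lunit X : @canonical (unit * X) X snd
| canon_luniti X : @canonical X (unit * X) (fun x => (tt, x))
| canon_swap X Y : @canonical (X * Y) (Y * X) (fun p => (p.2, p.1)).

Definition coalg_eqv (M : monad) T r (th ps : coalg M T r) : Prop :=
  exists f : state th -> state ps, canonical f /\ coalg_iso f.

Definition coalg_par (M : monad) T p q (th : coalg M T p) (ps : coalg M T q) :
    coalg M T (ptens p q) :=
  @Coalg M T (ptens p q) (state th * state ps)%type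
    (fun t xy => (out th t xy.1, out ps t xy.2))
    (fun t xy d => dst (upd th d.1) (upd ps d.2)).

Definition coalg_reindex (M : monad) T p q (l : lens p q) (th : coalg M T p) :
    coalg M T q :=
  @Coalg M T q (state th) (fun t x => onpos l (out th t x))
    (fun t x d => upd th (ondir l d)).

(** * Systems between linear polynomials *)

Definition system (M : monad) (T A B : Type) : Type :=
  coalg M T (ihom (lin A) (lin B)).

Definition sys_out M T A B (b : system M T A B) (t : T) (x : state b) (a : A) : B :=
  onpos (out b t x) a.

Definition sys_upd M T A B (b : system M T A B) (t : T) (x : state b) (a : A) :
    M (state b) :=
  upd b (existT (fun i => @dir (lin B) (onpos (out b t x) i)) a tt).

Arguments sys_out {M T A B} b t x a.
Arguments sys_upd {M T A B} b t x a.

Definition sys_comp M T A B C (b : system M T A B) (c : system M T B C) :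
    system M T A C :=
  coalg_reindex (ihom_comp (lin A) (lin B) (lin C)) (coalg_par b c).

Definition sys_tens M T A B A' B' (b : system M T A B) (b' : system M T A' B') :
    system M T (A * A') (B * B') :=
  coalg_reindex (ihom_map (lin_split A A') (lin_merge B B'))
    (coalg_reindex (ihom_tens (lin A) (lin B) (lin A') (lin B'))
       (coalg_par b b')).

(** The system with state space 1, trivial update and constant output [h]. *)
Definition static (M : monad) T A B (h : A -> B) : system M T A B :=
  @Coalg M T (ihom (lin A) (lin B)) unit (fun _ _ => lin_map h)
    (fun _ _ _ => eta tt).

Definition sys_id M T A : system M T A A := static M T id.

Definition sys_copy M T A : system M T A (A * A) := static M T (fun a => (a, a)).

Definition sys_del M T A : system M T A unit := static M T (fun _ => tt).

Lemma sys_comp_outE M T A B C (b : system M T A B) (c : system M T B C)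
    t (x : state b) (y : state c) a :
  sys_out (sys_comp b c) t (x, y) a = sys_out c t y (sys_out b t x a).
Proof. by []. Qed.

Lemma sys_comp_updE M T A B C (b : system M T A B) (c : system M T B C)
    t (x : state b) (y : state c) a :
  sys_upd (sys_comp b c) t (x, y) a
  = dst (sys_upd b t x a) (sys_upd c t y (sys_out b t x a)).
Proof.
by rewrite /sys_upd /=; case: (ondir (out c t y) _).
Qed.

Lemma sys_tens_outE M T A B A' B' (b : system M T A B) (b' : system M T A' B')
    t (x : state b) (y : state b') a a' :
  sys_out (sys_tens b b') t (x, y) (a, a') = (sys_out b t x a, sys_out b' t y a').
Proof. by []. Qed.

Lemma sys_tens_updE M T A B A' B' (b : system M T A B) (b' : system M T A' B')
    t (x : state b) (y : state b') a a' :
  sys_upd (sys_tens b b') t (x, y) (a, a')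
  = dst (sys_upd b t x a) (sys_upd b' t y a').
Proof. by []. Qed.

Lemma static_flow M (T : Type) (zero : T) (add : Monoid.law zero) A B
    (h : A -> B) : is_flow add (static M T h).
Proof.
move=> s; split=> [[]|t1 t2 x] //.
by rewrite /kleisli /coalg_closure /= eta_nat mu_eta.
Qed.

(** * Copy-discard categories, with hom-setoids *)

Record cd_data := CDData {
  ob : Type;
  hom : ob -> ob -> Type;
  eqv : forall A B, hom A B -> hom A B -> Prop;
  idm : forall A, hom A A;
  ccomp : forall A B C, hom A B -> hom B C -> hom A C;
  otens : ob -> ob -> ob;
  ounit : ob;
  tens : forall A B A' B', hom A B -> hom A' B' ->
    hom (otens A A') (otens B B');
  assoc : forall A B C, hom (otens (otens A B) C) (otens A (otens B C));
  associ : forall A B C, hom (otens A (otens B C)) (otens (otens A B) C);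
  lunit : forall A, hom (otens ounit A) A;
  luniti : forall A, hom A (otens ounit A);
  runit : forall A, hom (otens A ounit) A;
  runiti : forall A, hom A (otens A ounit);
  braid : forall A B, hom (otens A B) (otens B A);
  copy : forall A, hom A (otens A A);
  del : forall A, hom A ounit
}.

Declare Scope cd_scope.
Local Open Scope cd_scope.
Notation "f ≈ g" := (eqv f g) (at level 70) : cd_scope.
Notation "f ∙ g" := (ccomp f g) (at level 45, left associativity) : cd_scope.
Notation "f ⊗ g" := (tens f g) (at level 40, left associativity) : cd_scope.
Notation "A ⊠ B" := (otens A B) (at level 40, left associativity) : cd_scope.

(** [f ∙ g] is diagrammatic: first [f], then [g]. *)
Definition middle_swap (K : cd_data) (A B C D : ob K) :
    hom ((A ⊠ B) ⊠ (C ⊠ D)) ((A ⊠ C) ⊠ (B ⊠ D)) :=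
  assoc A B (C ⊠ D)
  ∙ (idm A ⊗ (associ B C D ∙ (braid B C ⊗ idm D) ∙ assoc C B D))
  ∙ associ A C (B ⊠ D).

Record is_category (K : cd_data) : Prop := {
  eqv_refl : forall (A B : ob K) (f : hom A B), f ≈ f;
  eqv_sym : forall (A B : ob K) (f g : hom A B), f ≈ g -> g ≈ f;
  eqv_trans : forall (A B : ob K) (f g h : hom A B), f ≈ g -> g ≈ h -> f ≈ h;
  ccomp_eqv : forall (A B C : ob K) (f f' : hom A B) (g g' : hom B C),
    f ≈ f' -> g ≈ g' -> f ∙ g ≈ f' ∙ g';
  ccomp_idl : forall (A B : ob K) (f : hom A B), idm A ∙ f ≈ f;
  ccomp_idr : forall (A B : ob K) (f : hom A B), f ∙ idm B ≈ f;
  ccomp_assoc : forall (A B C D : ob K) (f : hom A B) (g : hom B C) (h : hom C D),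
    (f ∙ g) ∙ h ≈ f ∙ (g ∙ h)
}.

Record is_symmetric_monoidal (K : cd_data) : Prop := {
  smc_cat : is_category K;
  tens_eqv : forall (A B A' B' : ob K) (f g : hom A B) (f' g' : hom A' B'),
    f ≈ g -> f' ≈ g' -> f ⊗ f' ≈ g ⊗ g';
  tens_id : forall A B : ob K, idm A ⊗ idm B ≈ idm (A ⊠ B);
  tens_comp : forall (A B C A' B' C' : ob K) (f : hom A B) (g : hom B C)
      (f' : hom A' B') (g' : hom B' C'),
    (f ∙ g) ⊗ (f' ∙ g') ≈ (f ⊗ f') ∙ (g ⊗ g');
  assoc_nat : forall (A B A' B' A2 B2 : ob K) (f : hom A B) (f' : hom A' B')
      (f2 : hom A2 B2),
    ((f ⊗ f') ⊗ f2) ∙ assoc B B' B2 ≈ assoc A A' A2 ∙ (f ⊗ (f' ⊗ f2));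
  lunit_nat : forall (A B : ob K) (f : hom A B),
    (idm (ounit K) ⊗ f) ∙ lunit B ≈ lunit A ∙ f;
  runit_nat : forall (A B : ob K) (f : hom A B),
    (f ⊗ idm (ounit K)) ∙ runit B ≈ runit A ∙ f;
  braid_nat : forall (A B A' B' : ob K) (f : hom A B) (f' : hom A' B'),
    (f ⊗ f') ∙ braid B B' ≈ braid A A' ∙ (f' ⊗ f);
  assocK : forall A B C : ob K,
    assoc A B C ∙ associ A B C ≈ idm ((A ⊠ B) ⊠ C);
  associK : forall A B C : ob K,
    associ A B C ∙ assoc A B C ≈ idm (A ⊠ (B ⊠ C));
  lunitK : forall A : ob K, lunit A ∙ luniti A ≈ idm (ounit K ⊠ A);
  lunitiK : forall A : ob K, luniti A ∙ lunit A ≈ idm A;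
  runitK : forall A : ob K, runit A ∙ runiti A ≈ idm (A ⊠ ounit K);
  runitiK : forall A : ob K, runiti A ∙ runit A ≈ idm A;
  braidK : forall A B : ob K, braid A B ∙ braid B A ≈ idm (A ⊠ B);
  triangle : forall A B : ob K,
    assoc A (ounit K) B ∙ (idm A ⊗ lunit B) ≈ runit A ⊗ idm B;
  pentagon : forall A B C D : ob K,
    (assoc A B C ⊗ idm D) ∙ assoc A (B ⊠ C) D ∙ (idm A ⊗ assoc B C D)
    ≈ assoc (A ⊠ B) C D ∙ assoc A B (C ⊠ D);
  hexagon : forall A B C : ob K,
    assoc A B C ∙ braid A (B ⊠ C) ∙ assoc B C A
    ≈ (braid A B ⊗ idm C) ∙ assoc B A C ∙ (idm B ⊗ braid A C)
}.

Record is_commutative_comonoid (K : cd_data) (A : ob K)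
    (d : hom A (A ⊠ A)) (e : hom A (ounit K)) : Prop := {
  coassoc : d ∙ (d ⊗ idm A) ∙ assoc A A A ≈ d ∙ (idm A ⊗ d);
  counitl : d ∙ (e ⊗ idm A) ∙ lunit A ≈ idm A;
  counitr : d ∙ (idm A ⊗ e) ∙ runit A ≈ idm A;
  cocomm : d ∙ braid A A ≈ d
}.

Record is_copy_discard (K : cd_data) : Prop := {
  cd_smc : is_symmetric_monoidal K;
  cd_comonoid : forall A : ob K, is_commutative_comonoid (copy A) (del A);
  copy_tens : forall A B : ob K,
    copy (A ⊠ B) ≈ (copy A ⊗ copy B) ∙ middle_swap A A B B;
  del_tens : forall A B : ob K,
    del (A ⊠ B) ≈ (del A ⊗ del B) ∙ lunit (ounit K);
  copy_unit : copy (ounit K) ≈ luniti (ounit K);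
  del_unit : del (ounit K) ≈ idm (ounit K)
}.

(** * The copy-discard structure on systems *)

(** A class of systems closed under composition and tensor and containing the
    static ones. Since the flow condition itself is not closed, the structure is
    built on any such class; see [all_systems], [still_systems], [flow_systems]. *)
Record sys_class (M : monad) (T : Type) := SysClass {
  in_class :> forall A B, system M T A B -> Prop;
  class_static : forall A B (h : A -> B), in_class (static M T h);
  class_comp : forall A B C (b : system M T A B) (c : system M T B C),
    in_class b -> in_class c -> in_class (sys_comp b c);
  class_tens : forall A B A' B' (b : system M T A B) (b' : system M T A' B'),
    in_class b -> in_class b' -> in_class (sys_tens b b')
}.

(** The object Ay is represented by the type [A], and Ay ⊗ By by [A * B]. *)
Definition sys_cd (M : monad) (T : Type) (P : sys_class M T) : cd_data :=
  let st A B (h : A -> B) := exist (@P A B) (static M T h) (class_static P h) in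
  @CDData Type (fun A B => {b : system M T A B | P A B b})
    (fun A B b c => coalg_eqv (sval b) (sval c))
    (fun A => exist (@P A A) (sys_id M T A) (class_static P id))
    (fun A B C b c => exist (@P A C) (sys_comp (sval b) (sval c))
                        (class_comp (svalP b) (svalP c)))
    prod unit
    (fun A B A' B' b b' =>
       exist (@P (A * A')%type (B * B')%type) (sys_tens (sval b) (sval b'))
         (class_tens (svalP b) (svalP b')))
    (fun A B C => st _ _ (fun p : A * B * C => (p.1.1, (p.1.2, p.2))))
    (fun A B C => st _ _ (fun p : A * (B * C) => (p.1, p.2.1, p.2.2)))
    (fun A => st _ _ (fun p : unit * A => p.2))
    (fun A => st _ _ (fun a : A => (tt, a)))
    (fun A => st _ _ (fun p : A * unit => p.1))
    (fun A => st _ _ (fun a : A => (a, tt)))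
    (fun A B => st _ _ (fun p : A * B => (p.2, p.1)))
    (fun A => exist (@P A (A * A)%type) (sys_copy M T A)
                (class_static P (fun a => (a, a))))
    (fun A => exist (@P A unit) (sys_del M T A) (class_static P (fun _ => tt))).

(** The class of all systems, without the flow condition. *)
Definition all_systems (M : monad) (T : Type) : sys_class M T :=
  @SysClass M T (fun _ _ _ => True) (fun _ _ _ => I)
    (fun _ _ _ _ _ _ _ => I) (fun _ _ _ _ _ _ _ _ => I).

(** The systems whose state never changes. They satisfy the flow condition
    unconditionally, so for this class [sys_cd] is a part of Hier|_E that
    contains the whole structure and every composite in the comonoid laws. *)
Definition is_still (M : monad) (T A B : Type) (b : system M T A B) : Prop :=
  forall t x d, upd b (t := t) (x := x) d = eta x.

Lemma still_flow M (T : Type) (zero : T) (add : Monoid.law zero) A B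
    (b : system M T A B) : is_still b -> is_flow add b.
Proof.
move=> h s; split=> [x|t1 t2 x]; rewrite /kleisli /coalg_closure !h //.
by rewrite eta_nat mu_eta h.
Qed.

Lemma dst_eta (M : monad) X Y (x : X) (y : Y) :
  dst (eta x) (eta y) = eta (x, y) :> M (X * Y)%type.
Proof. by rewrite /dst eta_nat mu_eta /strength eta_nat. Qed.

Definition still_systems (M : monad) (T : Type) : sys_class M T.
Proof.
refine (@SysClass M T (@is_still M T) _ _ _).
- by move=> A B h t [] d.
- by move=> A B C b c hb hc t [x y] d /=; rewrite hb hc dst_eta.
- by move=> A B A' B' b b' hb hb' t [x y] d /=; rewrite hb hb' dst_eta.
Defined.

Record hier_closed (M : monad) (T : Type) (zero : T) (add : Monoid.law zero) :
    Prop := HierClosed {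
  flow_comp : forall A B C (b : system M T A B) (c : system M T B C),
    is_flow add b -> is_flow add c -> is_flow add (sys_comp b c);
  flow_tens : forall A B A' B' (b : system M T A B) (b' : system M T A' B'),
    is_flow add b -> is_flow add b' -> is_flow add (sys_tens b b')
}.

Definition flow_systems (M : monad) (T : Type) (zero : T) (add : Monoid.law zero)
    (H : hier_closed M add) : sys_class M T :=
  @SysClass M T (fun A B => @is_flow M T zero add (ihom (lin A) (lin B)))
    (static_flow M add) (flow_comp H) (flow_tens H).

(** Hier|_E, whose composition and tensor make sense exactly when [H] holds. *)
Definition Hier (M : monad) (T : Type) (zero : T) (add : Monoid.law zero)
    (H : hier_closed M add) : cd_data :=
  sys_cd (flow_systems H).

(** Failure of coalg_closure for the identity monad and the time monoid (nat, +): the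
    composite of the stateless system 1y -> nat y that outputs [t] at time [t]
    with the system nat y -> 1y on [nat] updating by [y |-> y + t * b] updates
    by [y |-> y + t * t]. *)
Definition id_monad : monad.
Proof. by apply: (@Monad id (fun _ _ f => f) (fun _ x => x) (fun _ x => x)). Defined.

Lemma hier_not_closed : ~ hier_closed id_monad (addn : Monoid.law 0).
Proof.
move=> [H _].
pose b : system id_monad nat unit nat :=
  @Coalg id_monad nat (ihom (lin unit) (lin nat)) unit
    (fun t _ => lin_map (fun _ => t)) (fun _ _ _ => tt).
pose c : system id_monad nat nat unit :=
  @Coalg id_monad nat (ihom (lin nat) (lin unit)) nat
    (fun _ _ => lin_map (fun _ => tt)) (fun t y d => y + t * projT1 d).
have fb : is_flow (addn : Monoid.law 0) b by move=> s; split=> [[]|].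
have fc : is_flow (addn : Monoid.law 0) c.
  move=> s; split=> [x|t1 t2 x]; rewrite /kleisli /coalg_closure /=.
    by rewrite mul0n addn0.
  by rewrite mulnDl (addnC (t1 * _)) addnA.
have [_ /(_ 1 1 (tt, 0))] := H _ _ _ b c fb fc (fun f => existT _ tt tt).
by [].
Qed.

(* Main.v *)
Require Import Defs.
From mathcomp Require Import all_boot.
From Stdlib Require Import FunctionalExtensionality.

Set Implicit Arguments.
Unset Strict Implicit.
Unset Printing Implicit Defensive.

(** For systems between linear polynomials, an isomorphism of coalgebras
    preserving outputs is a bijection commuting with the output and update maps
    pointwise in the input: constant sections already see every input.
    Composing with a static system only relabels inputs or outputs, up to a unit
    isomorphism of state spaces. So every law between static systems is an
    identity of functions, and the naturality and interchange laws are the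
    coherence of [dst], which comes from writing [dst] as two nested Kleisli
    extensions and exchanging them by commutativity of the monad. *)

(** * Kleisli extension and exchange of effects *)

Section Bind.
Variable M : monad.

Definition bind X Y (m : M X) (k : X -> M Y) : M Y := mu (fmap k m).

Lemma bind_eta X Y (x : X) (k : X -> M Y) : bind (eta x) k = k x.
Proof. by rewrite /bind eta_nat mu_eta. Qed.

Lemma eq_bind X Y (m : M X) (k k' : X -> M Y) : k =1 k' -> bind m k = bind m k'.
Proof. by move=> /functional_extensionality ->. Qed.

Lemma fmap_bind X Y (f : X -> Y) (m : M X) : fmap f m = bind m (eta \o f).
Proof. by rewrite /bind fmap_comp mu_fmap_eta. Qed.

Lemma bindA X Y Z (m : M X) (k : X -> M Y) (l : Y -> M Z) :
  bind (bind m k) l = bind m (fun x => bind (k x) l).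
Proof.
rewrite /bind mu_nat mu_mu -fmap_comp -fmap_comp.
by congr (mu (fmap _ m)).
Qed.

Lemma dst_bind X Y (m : M X) (n : M Y) :
  dst m n = bind m (fun x => bind n (fun y => eta (x, y))).
Proof. by apply: eq_bind => x; rewrite /strength fmap_bind. Qed.

Hypothesis hM : commutative_monad M.

(** Commutativity speaks only of pairs; binding both expressions for [dst m n] to the uncurried [k]
    extends it to any continuation. The rewriting only flattens the two sides into nested binds. *)
Lemma bindC X Y Z (m : M X) (n : M Y) (k : X -> Y -> M Z) :
  bind m (fun x => bind n (k x)) = bind n (fun y => bind m (k^~ y)).
Proof.
have := congr1 (fun d => bind d (fun p => k p.1 p.2)) (hM m n).
rewrite dst_bind -/(bind n _) !bindA.
under eq_bind => x do rewrite bindA.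
under [in X in _ = X -> _]eq_bind => y do rewrite /costrength fmap_bind bindA.
under eq_bind => x do under eq_bind => y do rewrite bind_eta.
by under [in X in _ = X -> _]eq_bind => y
  do under eq_bind => x do rewrite /= bind_eta.
Qed.

End Bind.

(** * Coherence of the double strength *)

Section Dst.
Variable M : monad.

Lemma dst_etal X Y (x : X) (n : M Y) : dst (eta x) n = fmap (pair x) n.
Proof. by rewrite /dst eta_nat mu_eta. Qed.

Lemma dst_etar X Y (m : M X) (y : Y) : dst m (eta y) = fmap (pair^~ y) m.
Proof.
by rewrite dst_bind fmap_bind; apply: eq_bind => x; rewrite bind_eta.
Qed.

Lemma dst_nat X Y X' Y' (f : X -> X') (g : Y -> Y') (m : M X) (n : M Y) :
  fmap (fun p => (f p.1, g p.2)) (dst m n) = dst (fmap f m) (fmap g n).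
Proof.
rewrite !dst_bind !fmap_bind !bindA; apply: eq_bind => x.
rewrite bindA bind_eta bindA; apply: eq_bind => y.
by rewrite !bind_eta.
Qed.

Lemma dst_assoc X Y Z (m : M X) (n : M Y) (o : M Z) :
  fmap (fun p => (p.1.1, (p.1.2, p.2))) (dst (dst m n) o) = dst m (dst n o).
Proof.
rewrite !dst_bind !fmap_bind !bindA; apply: eq_bind => x.
rewrite !bindA; apply: eq_bind => y; rewrite bind_eta !bindA.
by apply: eq_bind => z; rewrite !bind_eta.
Qed.

Hypothesis hM : commutative_monad M.

Lemma dst_swap X Y (m : M X) (n : M Y) :
  fmap (fun p => (p.2, p.1)) (dst m n) = dst n m.
Proof.
rewrite [RHS]dst_bind (bindC hM) dst_bind fmap_bind bindA.
apply: eq_bind => x; rewrite bindA; apply: eq_bind => y.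
by rewrite bind_eta.
Qed.

Lemma dst_interchange X Y X' Y' (m : M X) (n : M Y) (m' : M X') (n' : M Y') :
  fmap (fun p => ((p.1.1, p.2.1), (p.1.2, p.2.2))) (dst (dst m n) (dst m' n'))
  = dst (dst m m') (dst n n').
Proof.
(* Normal form of a fourfold [dst], with the effects in the order [a], [b], [c], [d]. *)
have dst4 U V U' V' (a : M U) (b : M V) (c : M U') (d : M V') :
    dst (dst a b) (dst c d) =
    bind a (fun x => bind b (fun y => bind c (fun z => bind d (fun w =>
      eta ((x, y), (z, w)))))).
  rewrite !dst_bind !bindA; apply: eq_bind => x.
  rewrite bindA; apply: eq_bind => y; rewrite bind_eta bindA.
  apply: eq_bind => z; rewrite bindA; apply: eq_bind => w.
  by rewrite bind_eta.
rewrite !dst4 fmap_bind bindA; apply: eq_bind => x.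
(* The two sides differ only in the order of the effects of [n] and [m'], exchanged here. *)
rewrite [RHS](bindC hM) bindA; apply: eq_bind => y.
rewrite bindA; apply: eq_bind => z.
by rewrite bindA; apply: eq_bind => w; rewrite bind_eta.
Qed.

End Dst.

(** * Canonical bijections and lenses between linear polynomials *)

(** Each structural generator is inverted by a generator, and composites and products are inverted
    from their parts. This gives symmetry of [coalg_eqv] and the inverse demanded by [coalg_iso]. *)
Lemma canonical_inv X Y (f : X -> Y) : canonical f ->
  exists2 g : Y -> X, canonical g & cancel f g /\ cancel g f.
Proof.
elim=> {X Y f}.
- by move=> X; exists id; first exact: canon_id.
- move=> X Y Z f g _ [f' cf [fK f'K]] _ [g' cg [gK g'K]].
  exists (f' \o g'); first exact: canon_comp.
  by split=> x /=; rewrite ?gK ?fK ?f'K ?g'K.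
- move=> X Y X' Y' f f' _ [g cg [fK gK]] _ [g' cg' [f'K g'K]].
  exists (fun p => (g p.1, g' p.2)); first exact: canon_prod.
  by split=> -[x y] /=; rewrite ?fK ?gK ?f'K ?g'K.
- move=> X Y Z; exists (fun p => (p.1, p.2.1, p.2.2)); first exact: canon_associ.
  by split=> [[[]]|[? []]].
- move=> X Y Z; exists (fun p => (p.1.1, (p.1.2, p.2))); first exact: canon_assoc.
  by split=> [[? []]|[[]]].
- move=> X; exists (fun x => (tt, x)); first exact: canon_luniti.
  by split=> [[[]]|].
- move=> X; exists snd; first exact: canon_lunit.
  by split=> [|[[]]].
- move=> X Y; exists (fun p => (p.2, p.1)); first exact: canon_swap.
  by split=> [[]|[]].
Qed.

Lemma canonical_runit X : @canonical (X * unit) X fst.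
Proof. exact: (canon_comp (canon_swap X unit) (canon_lunit X)). Qed.

(** The middle four exchange: reassociate, swap the two inner factors, reassociate back. *)
Lemma canonical_interchange X Y X' Y' :
  @canonical ((X * Y) * (X' * Y')) ((X * X') * (Y * Y'))
    (fun p => ((p.1.1, p.2.1), (p.1.2, p.2.2))).
Proof.
have inner : @canonical (Y * (X' * Y')) (X' * (Y * Y'))
    (fun p => (p.2.1, (p.1, p.2.2))).
  exact: (canon_comp (canon_associ Y X' Y')
           (canon_comp (canon_prod (canon_swap Y X') (canon_id Y'))
             (canon_assoc X' Y Y'))).
exact: (canon_comp (canon_assoc X Y (X' * Y'))
         (canon_comp (canon_prod (canon_id X) inner)
           (canon_associ X X' (Y * Y')))).
Qed.

(** Directions of a linear polynomial live in [unit], so the map on positions carries all the data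
    of a lens. *)
Lemma eq_lens_lin A B (l l' : lens (lin A) (lin B)) : onpos l =1 onpos l' -> l = l'.
Proof.
case: l l' => [p d] [p' d'] /= /functional_extensionality e; subst p'.
congr Lens; apply: functional_extensionality_dep => i.
by apply: functional_extensionality => u; case: (d i u); case: (d' i u).
Qed.

(** * Equivalence of systems and the laws of composition and tensor *)

Section Systems.
Variables (M : monad) (T : Type).

Lemma upd_sys_upd A B (b : system M T A B) t x
    (d : @dir (ihom (lin A) (lin B)) (out b t x)) : upd b d = sys_upd b t x (projT1 d).
Proof. by case: d => a []. Qed.

Lemma sys_eqvP A B (b c : system M T A B) :
  coalg_eqv b c <->
  exists f : state b -> state c,
    [/\ canonical f,
        forall t x a, sys_out c t (f x) a = sys_out b t x a
      & forall t x a, fmap f (sys_upd b t x a) = sys_upd c t (f x) a].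
Proof.
split=> [[f [cf [[g [_ _ fm _]] fo]]] | [f [cf fo fu]]]; exists f.
  split=> // t x a; first by rewrite /sys_out fo.
  (* The constant section that picks the input [a] at every lens. *)
  exact: (fm t (fun l => existT (fun i => @dir (lin B) (onpos l i)) a tt) x).
have [g _ [fK gK]] := canonical_inv cf.
(* A section may depend on the whole output lens, so pointwise agreement of outputs must first
   become equality of lenses. *)
have {}fo t x : out c t (f x) = out b t x.
  by apply: eq_lens_lin => a; apply: fo.
have fm : coalg_mor f.
  by move=> t s x; rewrite /coalg_closure !upd_sys_upd fu fo.
split=> //; split=> //; exists g; split=> // t s y.
(* Writing [y] as [f (g y)] reduces the law for [g] to the law for [f]; then [g \o f] cancels. *)
rewrite -{1}[y]gK -fm -fmap_comp -[RHS]fmap_id.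
by congr fmap; apply: functional_extensionality => x /=; rewrite fK.
Qed.

Lemma sys_eqv_refl A B (b : system M T A B) : coalg_eqv b b.
Proof.
apply/sys_eqvP; exists id; split=> //; first exact: canon_id.
by move=> t x a; rewrite fmap_id.
Qed.

Lemma sys_eqv_sym A B (b c : system M T A B) : coalg_eqv b c -> coalg_eqv c b.
Proof.
move=> /sys_eqvP [f [cf fo fu]].
have [g cg [fK gK]] := canonical_inv cf.
apply/sys_eqvP; exists g; split=> // t y a; first by rewrite -fo gK.
rewrite -{1}[y]gK -fu -fmap_comp -[RHS]fmap_id.
by congr fmap; apply: functional_extensionality => x /=; rewrite fK.
Qed.

Lemma sys_eqv_trans A B (b c d : system M T A B) :
  coalg_eqv b c -> coalg_eqv c d -> coalg_eqv b d.
Proof.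
move=> /sys_eqvP [f [cf fo fu]] /sys_eqvP [g [cg go gu]].
apply/sys_eqvP; exists (g \o f); split; first exact: canon_comp.
  by move=> t x a /=; rewrite go fo.
by move=> t x a; rewrite fmap_comp fu gu.
Qed.

Lemma sys_comp_eqv A B C (b b' : system M T A B) (c c' : system M T B C) :
  coalg_eqv b b' -> coalg_eqv c c' -> coalg_eqv (sys_comp b c) (sys_comp b' c').
Proof.
move=> /sys_eqvP [f [cf fo fu]] /sys_eqvP [g [cg go gu]].
apply/sys_eqvP; exists (fun p => (f p.1, g p.2)); split.
- exact: canon_prod.
- by move=> t [x y] a; rewrite !sys_comp_outE /= go fo.
- by move=> t [x y] a; rewrite !sys_comp_updE dst_nat fu gu fo.
Qed.

Lemma sys_tens_eqv A B A' B' (b c : system M T A B) (b' c' : system M T A' B') :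
  coalg_eqv b c -> coalg_eqv b' c' -> coalg_eqv (sys_tens b b') (sys_tens c c').
Proof.
move=> /sys_eqvP [f [cf fo fu]] /sys_eqvP [g [cg go gu]].
apply/sys_eqvP; exists (fun p => (f p.1, g p.2)); split.
- exact: canon_prod.
- by move=> t [x y] [a a']; rewrite !sys_tens_outE /= go fo.
- by move=> t [x y] [a a']; rewrite !sys_tens_updE dst_nat fu gu.
Qed.

Lemma sys_comp_assoc A B C D (b : system M T A B) (c : system M T B C)
    (d : system M T C D) :
  coalg_eqv (sys_comp (sys_comp b c) d) (sys_comp b (sys_comp c d)).
Proof.
apply/sys_eqvP; exists (fun p => (p.1.1, (p.1.2, p.2))); split.
- exact: canon_assoc.
- by move=> t [[x y] z] a.
- by move=> t [[x y] z] a; rewrite !sys_comp_updE dst_assoc.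
Qed.

(** Normal form of composition with static systems: the interface changes, while the state space
    stays exactly the same, with no extra factor [unit]. *)
Definition relabel A A' B B' (u : A' -> A) (v : B -> B') (b : system M T A B) :
    system M T A' B' :=
  coalg_reindex (ihom_map (lin_map u) (lin_map v)) b.

Lemma relabel_updE A A' B B' (u : A' -> A) (v : B -> B') (b : system M T A B) t x a :
  sys_upd (relabel u v b) t x a = sys_upd b t x (u a).
Proof. by []. Qed.

Lemma sys_comp_static A B C (b : system M T A B) (v : B -> C) :
  coalg_eqv (sys_comp b (static M T v)) (relabel id v b).
Proof.
apply/sys_eqvP; exists fst; split=> [|t [x []] a|t [x []] a] //.
  exact: canonical_runit.
rewrite sys_comp_updE relabel_updE /= dst_etar -fmap_comp.
(* The remaining map [fst \o pair^~ tt] is convertible to [id]. *)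
exact: fmap_id.
Qed.

Lemma static_sys_comp A B C (u : A -> B) (b : system M T B C) :
  coalg_eqv (sys_comp (static M T u) b) (relabel u id b).
Proof.
apply/sys_eqvP; exists snd; split=> [|t [[] x] a|t [[] x] a] //.
  exact: canon_lunit.
rewrite sys_comp_updE relabel_updE /= dst_etal -fmap_comp.
exact: fmap_id.
Qed.

Lemma relabel_id A B (b : system M T A B) : coalg_eqv (relabel id id b) b.
Proof.
apply/sys_eqvP; exists id; split=> //; first exact: canon_id.
by move=> t x a; rewrite fmap_id.
Qed.

(** Both composites reduce to relabelings, so [f] has to compare only [b] and [c]. Every naturality
    square of a structure map is an instance. *)
Lemma static_natural A A' B B' (u : A -> A') (v : B -> B')
    (b : system M T A B) (c : system M T A' B') (f : state b -> state c) :
  canonical f ->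
  (forall t x a, sys_out c t (f x) (u a) = v (sys_out b t x a)) ->
  (forall t x a, fmap f (sys_upd b t x a) = sys_upd c t (f x) (u a)) ->
  coalg_eqv (sys_comp b (static M T v)) (sys_comp (static M T u) c).
Proof.
move=> cf fo fu; apply: sys_eqv_trans (sys_comp_static _ _) _.
apply: sys_eqv_trans (sys_eqv_sym (static_sys_comp _ _)).
by apply/sys_eqvP; exists f.
Qed.

Lemma static_comp A B C (u : A -> B) (v : B -> C) :
  coalg_eqv (sys_comp (static M T u) (static M T v)) (static M T (v \o u)).
Proof.
apply: sys_eqv_trans (sys_comp_static _ _) _.
apply/sys_eqvP; exists id; split=> //; first exact: canon_id.
by move=> t x a; rewrite fmap_id.
Qed.

Lemma static_tens A B A' B' (u : A -> B) (v : A' -> B') :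
  coalg_eqv (sys_tens (static M T u) (static M T v))
            (static M T (fun p => (u p.1, v p.2))).
Proof.
apply/sys_eqvP; exists fst; split=> [|t [[] []] [a a']|t [[] []] [a a']] //.
  exact: canonical_runit.
by rewrite sys_tens_updE /= /sys_upd /= dst_eta eta_nat.
Qed.

(** Asking only for equivalence to static systems lets normal forms propagate from the leaves of an
    expression to its root, as [to_static] does. *)
Lemma comp_eqv_static A B C (u : A -> B) (v : B -> C) b c :
  coalg_eqv b (static M T u) -> coalg_eqv c (static M T v) ->
  coalg_eqv (sys_comp b c) (static M T (v \o u)).
Proof.
by move=> hb hc; apply: sys_eqv_trans (sys_comp_eqv hb hc) (static_comp _ _).
Qed.

Lemma tens_eqv_static A B A' B' (u : A -> B) (v : A' -> B') b c :
  coalg_eqv b (static M T u) -> coalg_eqv c (static M T v) ->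
  coalg_eqv (sys_tens b c) (static M T (fun p => (u p.1, v p.2))).
Proof.
by move=> hb hc; apply: sys_eqv_trans (sys_tens_eqv hb hc) (static_tens _ _).
Qed.

Lemma eqv_of_static A B (u v : A -> B) b c :
  coalg_eqv b (static M T u) -> coalg_eqv c (static M T v) -> u =1 v ->
  coalg_eqv b c.
Proof.
move=> hb hc /functional_extensionality e; subst v.
by apply: sys_eqv_trans hb _; apply: sys_eqv_sym.
Qed.

Lemma tens_assoc_nat A B A' B' A2 B2 (b : system M T A B) (b' : system M T A' B')
    (b2 : system M T A2 B2) :
  coalg_eqv
    (sys_comp (sys_tens (sys_tens b b') b2)
      (static M T (fun p => (p.1.1, (p.1.2, p.2)))))
    (sys_comp (static M T (fun p => (p.1.1, (p.1.2, p.2))))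
      (sys_tens b (sys_tens b' b2))).
Proof.
apply: static_natural.
- exact: canon_assoc.
- by move=> t [[x y] z] [[a a'] a2].
- by move=> t [[x y] z] [[a a'] a2]; rewrite !sys_tens_updE dst_assoc.
Qed.

Lemma tens_lunit_nat A B (b : system M T A B) :
  coalg_eqv (sys_comp (sys_tens (sys_id M T unit) b) (static M T snd))
            (sys_comp (static M T snd) b).
Proof.
apply: static_natural.
- exact: canon_lunit.
- by move=> t [[] x] [[] a].
- move=> t [[] x] [[] a].
  by rewrite sys_tens_updE /= dst_etal -fmap_comp; apply: fmap_id.
Qed.

Lemma tens_runit_nat A B (b : system M T A B) :
  coalg_eqv (sys_comp (sys_tens b (sys_id M T unit)) (static M T fst))
            (sys_comp (static M T fst) b).
Proof.
apply: static_natural.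
- exact: canonical_runit.
- by move=> t [x []] [a []].
- move=> t [x []] [a []].
  by rewrite sys_tens_updE /= dst_etar -fmap_comp; apply: fmap_id.
Qed.

Hypothesis hM : commutative_monad M.

(** The two sides run the updates in opposite orders; [dst_swap] reconciles them. *)
Lemma tens_braid_nat A B A' B' (b : system M T A B) (b' : system M T A' B') :
  coalg_eqv (sys_comp (sys_tens b b') (static M T (fun p => (p.2, p.1))))
            (sys_comp (static M T (fun p => (p.2, p.1))) (sys_tens b' b)).
Proof.
apply: static_natural.
- exact: canon_swap.
- by move=> t [x y] [a a'].
- by move=> t [x y] [a a']; rewrite !sys_tens_updE (dst_swap hM).
Qed.

(** The state spaces agree up to the middle four exchange, and the updates by [dst_interchange]. *)
Lemma sys_tens_comp A B C A' B' C' (b : system M T A B) (c : system M T B C)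
    (b' : system M T A' B') (c' : system M T B' C') :
  coalg_eqv (sys_tens (sys_comp b c) (sys_comp b' c'))
            (sys_comp (sys_tens b b') (sys_tens c c')).
Proof.
apply/sys_eqvP; exists (fun p => ((p.1.1, p.2.1), (p.1.2, p.2.2))); split.
- exact: canonical_interchange.
- by move=> t [[x y] [x' y']] [a a'].
- move=> t [[x y] [x' y']] [a a'].
  rewrite sys_tens_updE !sys_comp_updE (dst_interchange hM).
  by rewrite sys_tens_outE !sys_tens_updE.
Qed.

End Systems.

(** * Automation for laws between static systems *)

(** The underlying function starts as an existential variable and is assembled from the leaves; the
    tactic fails on a leaf that is not static. *)
Ltac to_static :=
  lazymatch goal with
  | |- coalg_eqv (sys_comp _ _) _ => eapply comp_eqv_static; to_static
  | |- coalg_eqv (sys_tens _ _) _ => eapply tens_eqv_static; to_static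
  | |- coalg_eqv _ _ => exact: sys_eqv_refl
  end.

Ltac static_law :=
  intros; eapply eqv_of_static; [to_static | to_static |];
  let p := fresh "p" in intro p;
  repeat match goal with
  | q : (_ * _)%type |- _ => destruct q
  | q : unit |- _ => destruct q
  end; reflexivity.

(** * Assembly of the copy-discard structure *)

Section CopyDiscard.
Variables (M : monad) (T : Type) (P : sys_class M T).

Lemma sys_category : is_category (sys_cd P).
Proof.
split.
- move=> A B b; exact: sys_eqv_refl.
- move=> A B b c; exact: sys_eqv_sym.
- move=> A B b c d; exact: sys_eqv_trans.
- move=> A B C b b' c c'; exact: sys_comp_eqv.
- move=> A B b; exact: sys_eqv_trans (static_sys_comp _ _) (relabel_id _).
- move=> A B b; exact: sys_eqv_trans (sys_comp_static _ _) (relabel_id _).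
- move=> A B C D b c d; exact: sys_comp_assoc.
Qed.

Lemma sys_symmetric_monoidal :
  commutative_monad M -> is_symmetric_monoidal (sys_cd P).
Proof.
(* This closes the coherence laws between structure maps; the goals left over involve arbitrary
   systems. *)
move=> hM; split; rewrite /=; try static_law.
- exact: sys_category.
- move=> A B A' B' b c b' c'; exact: sys_tens_eqv.
- move=> *; exact: sys_tens_comp.
- move=> *; exact: tens_assoc_nat.
- move=> *; exact: tens_lunit_nat.
- move=> *; exact: tens_runit_nat.
- move=> *; exact: tens_braid_nat.
Qed.

Lemma sys_copy_discard : commutative_monad M -> is_copy_discard (sys_cd P).
Proof.
(* Compatibility of copying and discarding with the tensor and unit relates static systems only, as
   do the comonoid laws below. *)
move=> hM; split; rewrite /=; try static_law.
- exact: sys_symmetric_monoidal.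
- by move=> A; split; rewrite /=; static_law.
Qed.

End CopyDiscard.

Theorem mainTheorem8 (M : monad) (hM : commutative_monad M)
    (hM1 : exists f : M unit -> unit, bijective f)
    (T : Type) (zero : T) (add : Monoid.law zero) :
  [/\ forall A : Type, is_flow add (sys_copy M T A) /\ is_flow add (sys_del M T A),
      forall H : hier_closed M add, is_copy_discard (Hier H)
    & forall P : sys_class M T, is_copy_discard (sys_cd P)].
Proof.
split=> [A|H|P]; last 2 first.
(* [Hier H] unfolds to [sys_cd] of the class of flow systems. *)
- exact: sys_copy_discard.
- exact: sys_copy_discard.
by split; apply: static_flow.
Qed.
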